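(* Let $M$ be a connected matroid not isomorphic to $U_{1,1}$. Then $$\left\lceil \frac{\mu(M)}{2}\right\rceil\le \eta(M)\le\left\lceil \frac{r(M)}{2}\right\rceil \mu(M),$$ where $r(M)$ denotes the rank of $M$.
   Context: Matroids are finite, and connected matroids are understood to have nonempty ground set. $U_{1,1}$ is the one-element rank-$1$ uniform matroid. A join of a matroid $M$ on ground set $E(M)$ is a set $J\subseteq E(M)$ with $|J\cap C|\le |C|/2$ for every circuit $C$ of $M$. $\mu(M)$ is the maximum size of a join. Ear decompositions: for a nonempty sequence of circuits $C_1,\dots,C_t$ of $M$ put $D_0=\varnothing$ and $D_i=C_1\cup\dots\cup C_i$. The sequence is an ear decomposition of $M$ if $D_t=E(M)$ and for every $i\ge 2$: (E1) $C_i\cap D_{i-1}\neq\varnothing$; (E2) $C_i\setminus D_{i-1}\ne\varnothing$; (E3) no circuit $C$ of $M$ with $C\cap D_{i-1}\neq\varnothing$ and $C\setminus D_{i-1}\neq\varnothing$ has $C\setminus D_{i-1}$ properly contained in $C_i\setminus D_{i-1}$. The set $P_i=C_i\setminus D_{i-1}$ is the $i$th lobe; it is odd or even according to the parity of $|P_i|$. $\varphi(M)$ is the minimum number of even lobes over all ear decompositions of $M$. For a connected matroid $M$ not isomorphic to $U_{1,1}$, an ear decomposition exists, and $\eta(M):=\frac{r(M)+\varphi(M)}{2}$. *)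

(* Defs.v *)
From HB Require Import structures.
From mathcomp Require Import all_boot all_order all_algebra.

Set Implicit Arguments.
Unset Strict Implicit.
Unset Printing Implicit Defensive.

Import Order.TTheory GRing.Theory Num.Theory.

(** * Finite matroids, presented by their independent sets *)

Record matroid (T : finType) := Matroid {
  ground : {set T};
  indep : {set {set T}};
  indep_ground : forall I : {set T}, I \in indep -> I \subset ground;
  indep0 : set0 \in indep;
  indepS : forall I J : {set T}, I \subset J -> J \in indep -> I \in indep;
  indep_aug : forall I J : {set T}, I \in indep -> J \in indep -> #|I| < #|J| ->
    exists2 x, x \in J :\: I & x |: I \in indep
}.

Section Notions.
Variables (T : finType) (M : matroid T).

Definition dependent (A : {set T}) : bool :=
  (A \subset ground M) && (A \notin indep M).

Definition circuit (C : {set T}) : bool := minset dependent C.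

Definition rank : nat := \max_(I in indep M) #|I|.

(* The ground set is required to be nonempty. *)
Definition connected : bool :=
  (ground M != set0) &&
  [forall x in ground M, forall y in ground M, (x != y) ==>
     [exists C : {set T}, [&& circuit C, x \in C & y \in C]]].

Definition join (J : {set T}) : bool :=
  (J \subset ground M) &&
  [forall (C : {set T} | circuit C), #|J :&: C|.*2 <= #|C|].

Definition mu : nat := \max_(J : {set T} | join J) #|J|.

(* Circuits are indexed from 0: C_i is [nth set0 s i.-1], P_i is [lobe s i.-1], and
   [covered s i] is the union D_i of the first i circuits. *)
Definition covered (s : seq {set T}) (i : nat) : {set T} :=
  \bigcup_(C <- take i s) C.

Definition lobe (s : seq {set T}) (i : nat) : {set T} :=
  nth set0 s i :\: covered s i.

(* (E1), (E2) and (E3) for the next circuit C, where D is the union of the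
   previous ones. *)
Definition ear (D C : {set T}) : bool :=
  [&& C :&: D != set0,
      C :\: D != set0 &
      [forall C' : {set T},
         [&& circuit C', C' :&: D != set0 & C' :\: D != set0] ==>
         ~~ (C' :\: D \proper C :\: D)]].

Definition ear_decomposition (s : seq {set T}) : bool :=
  [&& s != [::],
      all circuit s,
      covered s (size s) == ground M &
      [forall i : 'I_(size s), (0 < i) ==> ear (covered s i) (nth set0 s i)]].

Definition even_lobes (s : seq {set T}) : nat :=
  #|[set i : 'I_(size s) | ~~ odd #|lobe s i|]|.

(* The minimum ranges over sequences of length at most #|ground M| only to make
   it finite; every ear decomposition satisfies this bound and has at most
   #|ground M| even lobes, see [ear_decomposition_size], [phi_le] and
   [phi_attained] below. *)
Definition phi : nat :=
  \big[minn/#|ground M|]_(s : {bseq #|ground M| of {set T}} |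
                           ear_decomposition s) even_lobes s.

Definition eta : rat := ((rank%:R + phi%:R) / 2)%R.

Lemma circuit_neq0 (C : {set T}) : circuit C -> C != set0.
Proof.
move=> /minsetp/andP[_ Cdep]; apply: contraNneq Cdep => ->; exact: indep0.
Qed.

Lemma ear_decomposition_size (s : seq {set T}) :
  ear_decomposition s -> size s <= #|ground M|.
Proof.
case/and4P=> _ /allP circ_s /eqP <- /forallP ear_s.
have cov i : i <= size s -> i <= #|covered s i|.
  elim: i => // i IHi lt_is; have le_i := IHi (ltnW lt_is).
  have lobe_neq0 : lobe s i != set0.
    case: (posnP i) => [i0|i_gt0].
      rewrite /lobe /covered i0 take0 big_nil setD0.
      by apply/circuit_neq0/circ_s/mem_nth; rewrite -i0.
    by have /implyP/(_ i_gt0)/and3P[] := ear_s (Ordinal lt_is).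
  have -> : covered s i.+1 = covered s i :|: lobe s i.
    rewrite /covered (take_nth set0 lt_is) -cats1 big_cat big_seq1 /=.
    by apply/setP=> x; rewrite !inE; case: (x \in _).
  rewrite cardsU disjoint_setI0 ?cards0 ?subn0; last first.
    by rewrite -setI_eq0 setIDA setIC setDE -setIA setICr setI0.
  by rewrite -addn1 leq_add // card_gt0.
exact: cov.
Qed.

Lemma phi_le (s : seq {set T}) : ear_decomposition s -> phi <= even_lobes s.
Proof.
move=> ear_s; rewrite /phi -minEnat -leEnat.
exact: (@bigmin_le_cond _ _ _ _ (Bseq (ear_decomposition_size ear_s))).
Qed.

Lemma phi_attained :
  (exists s, ear_decomposition s) ->
  exists2 s, ear_decomposition s & even_lobes s = phi.
Proof.
case=> s ear_s; pose b := Bseq (ear_decomposition_size ear_s).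
rewrite /phi -minEnat (@bigmin_eq_arg _ _ _ _ b) //; last first.
  move=> t ear_t; rewrite leEnat (leq_trans (max_card _)) // card_ord.
  exact: ear_decomposition_size.
by case: arg_minP => // t ear_t _; exists t.
Qed.

End Notions.

(* An isomorphism is a bijection between the ground sets, seen as types. *)
Definition isomorphic (T U : finType) (M : matroid T) (N : matroid U) : Prop :=
  exists2 f : {x | x \in ground M} -> {y | y \in ground N},
    bijective f &
    forall A : {set {x | x \in ground M}},
      (val @: A \in indep M) = (val @: (f @: A) \in indep N).

Section Uniform.
Variables r n : nat.

Let uindep : {set {set 'I_n}} := [set I : {set 'I_n} | #|I| <= r].

Fact uniform_ground (I : {set 'I_n}) : I \in uindep -> I \subset [set: 'I_n].
Proof. by rewrite subsetT. Qed.

Fact uniform0 : set0 \in uindep.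
Proof. by rewrite inE cards0. Qed.

Fact uniformS (I J : {set 'I_n}) : I \subset J -> J \in uindep -> I \in uindep.
Proof. by rewrite !inE => /subset_leq_card; apply: leq_trans. Qed.

Fact uniform_aug (I J : {set 'I_n}) :
  I \in uindep -> J \in uindep -> #|I| < #|J| ->
  exists2 x, x \in J :\: I & x |: I \in uindep.
Proof.
rewrite !inE => _ Jr ltIJ.
have /subsetPn[x xJ xI] : ~~ (J \subset I).
  by apply: contraL ltIJ => /subset_leq_card; rewrite -leqNgt.
exists x; rewrite !inE ?xI //.
by rewrite cardsU1 xI add1n (leq_trans ltIJ).
Qed.

(* The uniform matroid U_{r,n}. *)
Definition uniform : matroid 'I_n :=
  Matroid uniform_ground uniform0 uniformS uniform_aug.

End Uniform.

(* Main.v *)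
Require Import Defs.
From mathcomp Require Import all_boot all_order all_algebra.
From mathcomp Require Import zify lra.

(** Write r, mu and phi for the rank, the maximum size of a join and the minimum
    number of even lobes. The bounds compare integers.

    A lobe P of an ear decomposition is a circuit of the contraction M / D, where
    D is the union of the earlier circuits: (E3) excludes smaller traces of
    circuits that meet D, and a circuit that avoids D cannot lie inside another
    circuit. So P raises the rank by #|P| - 1 ([rk_add_lobe], [rk_ear]). Summing
    over the lobes, r and phi have the same parity, and phi <= r because an even
    lobe has at least two points ([ear_built_rk], [phi_rank]).

    A join contains no circuit, so it is independent and mu <= r. With the parity
    of r + phi this yields the lower bound. For the upper bound, r + phi <= 2 r
    suffices when mu >= 2. If r > 0 there are no loops, so a single point is a
    join and mu >= 1. What is left is mu = 1, where parity reduces the claim to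
    phi <= 1 ([phi_le1]).

    If mu = 1, no pair of points is a join, so any two points lie on a common
    circuit with at most three points ([short_circuit]): in geometric language,
    every line has at least three points. An ear decomposition with at most one
    even lobe is grown from a triangle when r >= 2. A point in the closure of the part D
    built so far is added as a one-point lobe ([ear_single]). While at least two
    ranks are missing, a three-point lobe raises the rank by two
    ([ear_triple]); if one rank is missing, a single two-point lobe finishes
    ([ear_double], [ear_built_completion]). *)

Set Implicit Arguments.
Unset Strict Implicit.
Unset Printing Implicit Defensive.

(** * Rank of a set and closure *)

Section MatroidRank.
Variables (T : finType) (M : matroid T).
Implicit Types (A B C D I J P X : {set T}) (x y z : T).

Definition rk A : nat := \max_(I in indep M | I \subset A) #|I|.

Lemma rk_ge I A : I \in indep M -> I \subset A -> #|I| <= rk A.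
Proof. by move=> Ii IA; apply: (@leq_bigmax_cond _ _ _ I); rewrite Ii. Qed.

Lemma rk_attained A : exists2 B, B \in indep M & B \subset A /\ #|B| = rk A.
Proof.
pose Q := [pred I : {set T} | (I \in indep M) && (I \subset A)].
have Q0 : 0 < #|Q|.
  by apply/card_gt0P; exists set0; rewrite !inE indep0 sub0set.
have [B /andP[Bi BA] e] := eq_bigmax_cond (fun I : {set T} => #|I|) Q0.
by exists B.
Qed.

Lemma rk_mono A B : A \subset B -> rk A <= rk B.
Proof.
move=> sAB; have [I Ii [IA <-]] := rk_attained A.
exact: rk_ge Ii (subset_trans IA sAB).
Qed.

Lemma rk_squeeze A B : A \subset B -> rk B <= rk A -> rk B = rk A.
Proof. by move=> AB BA; apply/eqP; rewrite eqn_leq BA rk_mono. Qed.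

Lemma rk_le_card A : rk A <= #|A|.
Proof. by have [I _ [IA <-]] := rk_attained A; apply: subset_leq_card. Qed.

Lemma rk_indep I : I \in indep M -> rk I = #|I|.
Proof. by move=> Ii; apply/eqP; rewrite eqn_leq rk_le_card rk_ge. Qed.

Lemma rk_ground : rk (ground M) = rank M.
Proof.
apply: eq_bigl => I; apply: andb_idr; exact: indep_ground.
Qed.

Lemma basis_extend I A : I \in indep M -> I \subset A ->
  exists2 B, B \in indep M & [/\ I \subset B, B \subset A & #|B| = rk A].
Proof.
move=> Ii IA; have := rk_ge Ii IA.
have [n] := ubnP (rk A - #|I|); elim: n I Ii IA => // n IHn I Ii IA.
rewrite ltnS => le_n le_r; case: (eqVneq #|I| (rk A)) => [e|ne]; first by exists I.
have ltr : #|I| < rk A by rewrite ltn_neqAle ne.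
have [J Ji [JA eJ]] := rk_attained A.
have [|x] := indep_aug Ii Ji; first by rewrite eJ.
  rewrite inE => /andP[xI xJ] xIi.
have cx : #|x |: I| = #|I|.+1 by rewrite cardsU1 xI.
have xIA : x |: I \subset A by rewrite subUset sub1set (subsetP JA).
have [||B Bi [xIB BA eB]] := IHn _ xIi xIA; rewrite ?cx //; first lia.
by exists B => //; split => //; apply: subset_trans xIB; apply: subsetUr.
Qed.

(** A basis of [A] that no point of [X] can augment is still a basis of
    [A :|: X]: this is the idempotence of the closure operator. *)
Lemma rk_closure A X : (forall x, x \in X -> rk (x |: A) = rk A) ->
  rk (A :|: X) = rk A.
Proof.
move=> clX; have [B Bi [BA eB]] := rk_attained A.
apply: rk_squeeze (subsetUl _ _) _; rewrite leqNgt; apply/negP => lt.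
have [J Ji [JAX eJ]] := rk_attained (A :|: X).
have [|x] := indep_aug Bi Ji; first by rewrite eB eJ.
rewrite inE => /andP[xB xJ] xBi.
have cx : #|x |: B| = (rk A).+1 by rewrite cardsU1 xB eB.
have: (rk A).+1 <= rk (x |: A) by rewrite -cx rk_ge ?setUS.
have: x \in A :|: X by exact: (subsetP JAX).
rewrite inE => /orP[xA|/clX->]; last by rewrite ltnn.
by rewrite (setUidPr _) ?sub1set // ltnn.
Qed.

Lemma rkU1 x A : rk (x |: A) <= (rk A).+1.
Proof.
have [I Ii [IxA <-]] := rk_attained (x |: A).
have I'A : I :\ x \subset A by rewrite subDset.
have := rk_ge (indepS (subsetDl _ _) Ii) I'A.
by rewrite (cardsD1 x I); case: (x \in I) => /=; lia.
Qed.

Lemma rkU_card A P : rk (A :|: P) <= rk A + #|P|.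
Proof.
have [I Ii [IAP <-]] := rk_attained (A :|: P).
have sI : I :\: P \subset A by rewrite subDset setUC.
have := rk_ge (indepS (subsetDl _ _) Ii) sI.
by have := subset_leq_card (subsetIr I P); rewrite -(cardsID P I); lia.
Qed.

(** Submodularity: contracting a smaller set leaves more rank to [P]. *)
Lemma rk_contract_anti A D P : A \subset D ->
  rk (D :|: P) + rk A <= rk (A :|: P) + rk D.
Proof.
move=> AD; have [I Ii [IA eI]] := rk_attained A.
have [B Bi [IB BD eB]] := basis_extend Ii (subset_trans IA AD).
have [J Ji [BJ JDP eJ]] := basis_extend Bi (subset_trans BD (subsetUl _ P)).
have JD : #|J :&: D| <= rk D.
  by rewrite rk_ge ?subsetIr // (indepS _ Ji) ?subsetIl.
have IJ : I \subset J := subset_trans IB BJ.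
have KJ : I :|: J :\: D \subset J by rewrite subUset IJ subsetDl.
have KAP : I :|: J :\: D \subset A :|: P by rewrite setUSS ?subDset.
have := rk_ge (indepS KJ Ji) KAP.
rewrite cardsU disjoint_setI0 ?cards0 ?subn0; last first.
  apply/pred0P => z /=; rewrite !inE; apply/negP => /and3P[zI zD _].
  by rewrite (subsetP AD) ?(subsetP IA) in zD.
rewrite -eI -eJ -(cardsID D J) => le_rk.
by rewrite -addnA addnC [_ + #|I|]addnC leq_add.
Qed.

Lemma indep_of_rk A : rk A = #|A| -> A \in indep M.
Proof.
have [I Ii [IA <-]] := rk_attained A => e.
by have /eqP <- : I == A by rewrite eqEcard IA e leqnn.
Qed.

Lemma dependent_circuit A : A \subset ground M -> A \notin indep M ->
  exists2 C, circuit M C & C \subset A.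
Proof.
move=> AG Ai; have dA : dependent M A by rewrite /dependent AG.
by have [C mC CA] := minset_exists dA; exists C.
Qed.

Lemma circuit_ground C : circuit M C -> C \subset ground M.
Proof. by case/minsetp/andP. Qed.

Lemma circuit_dep C : circuit M C -> C \notin indep M.
Proof. by case/minsetp/andP. Qed.

Lemma circuit_sub C C' : circuit M C -> circuit M C' -> C' \subset C -> C' = C.
Proof. by move=> /minsetP[_ mC] /minsetp dC' /mC; apply. Qed.

Lemma circuit_proper_indep C I : circuit M C -> I \proper C -> I \in indep M.
Proof.
move=> cC ltIC; apply/negPn/negP => Ii.
have IG := subset_trans (proper_sub ltIC) (circuit_ground cC).
have [C' cC' sC'] := dependent_circuit IG Ii.
have := sub_proper_trans sC' ltIC.
by rewrite (circuit_sub cC cC' (subset_trans sC' (proper_sub ltIC))) properxx.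
Qed.

Lemma circuit_not_sub_indep C I : circuit M C -> I \in indep M -> ~~ (C \subset I).
Proof.
by move=> cC Ii; apply/negP => CI; have := circuit_dep cC; rewrite (indepS CI).
Qed.

Lemma rk_circuit_spans C x A : circuit M C -> x \in C -> C \subset x |: A ->
  rk (x |: A) = rk A.
Proof.
move=> cC xC CxA.
have [xA|xA] := boolP (x \in A); first by rewrite (setUidPr _) ?sub1set.
have Cx : C :\ x \subset A by rewrite subDset.
have Ci : C :\ x \in indep M by apply: circuit_proper_indep cC _; rewrite properD1.
have [B Bi [CB BA eB]] := basis_extend Ci Cx.
apply: rk_squeeze (subsetUr _ _) _; rewrite leqNgt; apply/negP => lt.
have [J Ji [JA eJ]] := rk_attained (x |: A).
have [|z] := indep_aug Bi Ji; first by rewrite eB eJ.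
rewrite inE => /andP[zB zJ] zBi.
have: z \in x |: A by exact: (subsetP JA).
rewrite !inE => /orP[/eqP ezx|zA].
  have /negP := circuit_not_sub_indep cC zBi; apply.
  by rewrite ezx -(setD1K xC) setUS.
have zBA : z |: B \subset A by rewrite subUset sub1set zA.
by have := rk_ge zBi zBA; rewrite cardsU1 zB eB ltnn.
Qed.

Lemma spanned_circuit x A : x \in ground M -> x \notin A -> rk (x |: A) = rk A ->
  exists C, [/\ circuit M C, x \in C & C \subset x |: A].
Proof.
move=> xG xA e; have [B Bi [BA eB]] := rk_attained A.
have xB : x \notin B by apply: contra xA; apply: (subsetP BA).
have xBi : x |: B \notin indep M.
  apply/negP => i; have := rk_ge i (setUS [set x] BA).
  by rewrite cardsU1 xB eB e ltnn.
have xBG : x |: B \subset ground M.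
  by rewrite subUset sub1set xG indep_ground.
have [C cC CxB] := dependent_circuit xBG xBi.
exists C; split=> //; last exact: subset_trans CxB (setUS _ BA).
apply/negPn/negP => xC; have /negP := circuit_not_sub_indep cC Bi; apply.
by rewrite -(setU1K xB) subsetD1 CxB.
Qed.

(** Contrapositive use: if adding [P] to [D] raises the rank by [#|P|], then [P]
    is independent in [M / D] and contains no trace of a circuit. *)
Lemma rk_circuit_deficit C D P : circuit M C -> C :\: D != set0 ->
  C \subset D :|: P -> rk (D :|: P) < rk D + #|P|.
Proof.
move=> cC /set0Pn[x]; rewrite inE => /andP[xD xC] CDP.
have xP : x \in P by have := subsetP CDP x xC; rewrite inE (negPf xD).
have e : D :|: P = x |: (D :|: P :\ x) by rewrite setUCA setD1K.
rewrite e (rk_circuit_spans cC xC) -?e // (cardsD1 x P) xP addnCA add1n ltnS.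
exact: rkU_card.
Qed.

Lemma setUD A B : A :|: (B :\: A) = A :|: B.
Proof. by apply/setP => z; rewrite !inE; case: (z \in A). Qed.

(** The hypothesis says that [C :\: D] is a circuit of the contraction [M / D]:
    the proof takes a basis of [D] containing [C :&: D], so that adding to it
    all of [C :\: D] but one point keeps it independent. *)
Lemma rk_add_lobe D C : circuit M C -> C :\: D != set0 ->
    (forall C', circuit M C' -> C' :\: D != set0 ->
       ~~ (C' :\: D \proper C :\: D)) ->
  rk (D :|: C) = rk D + #|C :\: D|.-1.
Proof.
move=> cC /[dup] PN0 /set0Pn[p]; rewrite inE => /andP[pD pC] minC.
have pP : p \in C :\: D by rewrite inE pD.
have [B Bi [BD eB]] := rk_attained D.
have disj : [disjoint B & (C :\: D) :\ p].
  apply/pred0P => z /=; rewrite !inE; apply/negP => /and4P[zB _ zD _].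
  by rewrite (subsetP BD) in zD.
have cBP : #|B :|: (C :\: D) :\ p| = rk D + #|C :\: D|.-1.
  rewrite cardsU disjoint_setI0 // cards0 subn0 eB.
  by rewrite [in RHS](cardsD1 p) pP.
have BPi : B :|: (C :\: D) :\ p \in indep M.
  apply/negPn/negP => dep.
  have BPG : B :|: (C :\: D) :\ p \subset ground M.
    rewrite subUset indep_ground //= (subset_trans (subsetDl _ _)) //.
    by rewrite (subset_trans (subsetDl _ _)) ?circuit_ground.
  have [C' cC' sC'] := dependent_circuit BPG dep.
  have C'N0 : C' :\: D != set0.
    rewrite setD_eq0; apply/negP => C'D.
    have /negP := circuit_not_sub_indep cC' Bi; apply.
    apply/subsetP => z zC'; have := subsetP sC' z zC'.
    by rewrite !inE (subsetP C'D _ zC') /= andbF orbF.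
  have /negP := minC C' cC' C'N0; apply.
  apply: sub_proper_trans (properD1 pP).
  apply/subsetP => z; rewrite inE => /andP[zD zC']; have := subsetP sC' z zC'.
  by rewrite inE => /orP[/(subsetP BD)|//]; rewrite (negPf zD).
apply/eqP; rewrite eqn_leq; apply/andP; split; last first.
  rewrite -cBP rk_ge // setUSS // (subset_trans (subsetDl _ _)) //.
  exact: subsetDl.
rewrite -ltnS -addnS prednK ?card_gt0 // -setUD.
by apply: rk_circuit_deficit PN0 _; rewrite ?setUD ?subsetUr.
Qed.

End MatroidRank.

(** * Ear decompositions and the rank *)

Section Ears.
Variables (T : finType) (M : matroid T).
Implicit Types (A B C D I J P X : {set T}) (x y z : T) (s : seq {set T}).

(** [ear_built k D]: some sequence of circuits with union [D] satisfies the ear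
    conditions and has [k] even lobes. Only [k] and [D] matter when a sequence is
    extended, so the induction principle avoids all indexing. *)
Inductive ear_built : nat -> {set T} -> Prop :=
| ear_built1 C : circuit M C -> ear_built (~~ odd #|C|) C
| ear_builtS k D C : ear_built k D -> circuit M C -> ear M D C ->
    ear_built (k + ~~ odd #|C :\: D|) (D :|: C).

Lemma ear_built_ground k D : ear_built k D -> D \subset ground M.
Proof.
elim=> [C /circuit_ground//|{}k {}D C _ DG cC _].
by rewrite subUset DG circuit_ground.
Qed.

Lemma ear_built_neq0 k D : ear_built k D -> D != set0.
Proof.
elim=> [C /circuit_neq0//|{}k {}D C _ D0 _ _].
by apply: contraNneq D0 => e; rewrite -subset0 -e subsetUl.
Qed.

Lemma lobe_parity n : 0 < n -> (~~ odd n <= n.-1) && (odd (~~ odd n) == odd n.-1).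
Proof. by case: n => // n _ /=; rewrite negbK; case: n => // n; case: odd. Qed.

Lemma rk_ear D C : circuit M C -> ear M D C ->
  rk M (D :|: C) = rk M D + #|C :\: D|.-1.
Proof.
move=> cC /and3P[_ PN0 /forallP minC]; apply: rk_add_lobe => // C' cC' P'N0.
have [C'D|C'D] := eqVneq (C' :&: D) set0; last first.
  by apply: (implyP (minC C')); apply/and3P.
(* A circuit disjoint from [D] is its own trace and cannot sit inside [C]. *)
have eC' : C' :\: D = C' by apply/setDidPl; rewrite -setI_eq0 C'D.
rewrite eC'; apply/negP => ltC'.
have sC' := subset_trans (proper_sub ltC') (subsetDl _ _).
by have := proper_sub_trans ltC' (subsetDl _ _); rewrite (circuit_sub cC cC' sC') properxx.
Qed.

(** The first lobe is the case [D = set0] of the rank formula. *)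
Lemma rk_circuit C : circuit M C -> rk M C = #|C|.-1.
Proof.
move=> cC; have := rk_add_lobe (D := set0) cC; rewrite setD0 set0U (circuit_neq0 cC).
have -> : rk M set0 = 0 by apply/eqP; rewrite -leqn0 -(cards0 T) rk_le_card.
rewrite add0n; apply=> // C' cC' _; apply/negP; rewrite setD0 => ltC'.
by move: (ltC'); rewrite (circuit_sub cC cC' (proper_sub ltC')) properxx.
Qed.

(** Each lobe [P] contributes [#|P|.-1] to the rank, which dominates its
    contribution 0 or 1 to [k] and has the same parity. *)
Lemma ear_built_rk k D : ear_built k D -> k <= rk M D /\ odd k = odd (rk M D).
Proof.
elim=> [C cC|{}k {}D C _ [le_k ek] cC eC].
  rewrite rk_circuit //; have := circuit_neq0 cC.
  by rewrite -card_gt0 => /lobe_parity/andP[-> /eqP].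
rewrite rk_ear //; case/and3P: eC => _; rewrite -card_gt0 => /lobe_parity/andP[le_P /eqP eP] _.
by rewrite leq_add // !oddD ek eP.
Qed.

Lemma even_lobesE s : even_lobes s = \sum_(i < size s) ~~ odd #|lobe s i|.
Proof.
rewrite /even_lobes -sum1_card big_mkcond; apply: eq_bigr => i _.
by rewrite inE; case: odd.
Qed.

Lemma coveredS s i : i < size s -> covered s i.+1 = covered s i :|: nth set0 s i.
Proof. by move=> lt_is; rewrite /covered (take_nth set0) // -cats1 big_cat big_seq1. Qed.

Lemma covered_rcons s C i : i <= size s -> covered (rcons s C) i = covered s i.
Proof. by move=> le_is; rewrite /covered -cats1 takel_cat. Qed.

Lemma ear_built_of_decomposition s : ear_decomposition M s ->
  ear_built (even_lobes s) (ground M).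
Proof.
case/and4P=> sN0 /allP cs /eqP <- /forallP es; rewrite even_lobesE.
rewrite -(big_mkord xpredT (fun i => ~~ odd #|lobe s i| : nat)).
suff prefix i : 0 < i <= size s ->
    ear_built (\sum_(0 <= j < i) ~~ odd #|lobe s j|) (covered s i).
  by apply: prefix; rewrite leqnn andbT lt0n size_eq0.
elim: i => // i IHi /andP[_ lt_is].
have ci : circuit M (nth set0 s i) by apply/cs/mem_nth.
rewrite big_nat_recr //= coveredS //.
have [i0|i_gt0] := posnP i.
  subst i; rewrite big_geq // /lobe /covered take0 big_nil setD0 set0U.
  exact: ear_built1.
apply: ear_builtS => //; first by apply: IHi; rewrite i_gt0 ltnW.
exact: implyP (es (Ordinal lt_is)) i_gt0.
Qed.

Lemma ear_built_seq k D : ear_built k D -> exists s,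
  [/\ s != [::], all (circuit M) s, covered s (size s) = D,
      (forall i, 0 < i < size s -> ear M (covered s i) (nth set0 s i)) &
      even_lobes s = k].
Proof.
elim=> [C cC|{}k {}D C _ [s [sN0 cs <- es <-]] cC eC].
  exists [:: C]; split=> //=; first by rewrite cC.
  - by rewrite /covered /= big_seq1.
  - by case.
  by rewrite even_lobesE big_ord1 /lobe /covered /= big_nil setD0.
exists (rcons s C); split.
- by case: (s).
- by rewrite all_rcons cC.
- rewrite size_rcons coveredS ?size_rcons // covered_rcons //.
  by rewrite nth_rcons ltnn eqxx.
- move=> i /andP[i_gt0]; rewrite size_rcons ltnS => le_is.
  rewrite covered_rcons // nth_rcons.
  case: ltngtP le_is => // [lt_is|->] _; last exact: eC.
  by apply: es; rewrite i_gt0.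
rewrite !even_lobesE size_rcons big_ord_recr /=; congr (_ + _).
  apply: eq_bigr => i _.
  by rewrite /lobe nth_rcons ltn_ord covered_rcons // ltnW.
by rewrite /lobe nth_rcons ltnn eqxx covered_rcons.
Qed.

Lemma ear_built_decomposition k : ear_built k (ground M) ->
  exists2 s, ear_decomposition M s & even_lobes s = k.
Proof.
case/ear_built_seq=> s [sN0 cs eG es ek]; exists s => //.
apply/and4P; split=> //; first by rewrite eG.
by apply/forallP => i; apply/implyP => i_gt0; apply: es; rewrite i_gt0 /=.
Qed.

(** In a connected matroid some circuit meets [D] without lying in it, and the one
    with the fewest points outside [D] is an ear. *)
Lemma ear_built_connected k D : connected M -> ear_built k D ->
  exists k', ear_built k' (ground M).
Proof.
move=> /andP[_ /forallP conM].
have [n] := ubnP #|ground M :\: D|; elim: n k D => // n IHn k D lt_n eD.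
have [GD|] := boolP (ground M \subset D).
  exists k; suff <- : D = ground M by [].
  by apply/eqP; rewrite eqEsubset GD (ear_built_ground eD).
case/subsetPn=> x xG xD; have /set0Pn[y yD] := ear_built_neq0 eD.
have yG := subsetP (ear_built_ground eD) y yD.
have: [exists C : {set T}, [&& circuit M C, x \in C & y \in C]].
  have /implyP/(_ xG)/forallP/(_ y)/implyP/(_ yG)/implyP := conM x; apply.
  by apply: contraNneq xD => ->.
case/existsP=> C0 /and3P[cC0 xC0 yC0].
pose Q C := [&& circuit M C, C :&: D != set0 & C :\: D != set0].
have QC0 : Q C0.
  rewrite /Q cC0 /=; apply/andP; split; apply/set0Pn.
    by exists y; rewrite inE yC0.
  by exists x; rewrite inE xC0 xD.
pose C := [arg min_(C < C0 | Q C) #|C :\: D|].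
have [cC CD CND minC] : [/\ circuit M C, C :&: D != set0, C :\: D != set0 &
    forall C', Q C' -> #|C :\: D| <= #|C' :\: D|].
  by rewrite /C; case: arg_minnP => // C1 /and3P[].
apply: (IHn (k + ~~ odd #|C :\: D|) (D :|: C)).
  rewrite -ltnS; apply: leq_trans lt_n; rewrite ltnS; apply: proper_card.
  apply/properP; split; first by rewrite setDS ?subsetUl.
  have /set0Pn[z] := CND; rewrite inE => /andP[zD zC]; exists z; last first.
    by rewrite !inE zC orbT.
  by rewrite inE zD (subsetP (circuit_ground cC)).
apply: ear_builtS => //; apply/and3P; split=> //.
apply/forallP => C'; apply/implyP => /minC; rewrite leqNgt.
exact/contra/proper_card.
Qed.

Lemma phi_le_built k : ear_built k (ground M) -> phi M <= k.
Proof. by case/ear_built_decomposition=> s es <-; apply: phi_le. Qed.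

Lemma phi_rank k : ear_built k (ground M) ->
  phi M <= rank M /\ odd (phi M) = odd (rank M).
Proof.
case/ear_built_decomposition=> s es _.
have [|s' es' <-] := @phi_attained T M; first by exists s.
by rewrite -rk_ground; apply/ear_built_rk/ear_built_of_decomposition.
Qed.

End Ears.

(** * Joins, and matroids in which no join has two points *)

Section Joins.
Variables (T : finType) (M : matroid T).
Implicit Types (A B C D I J P X : {set T}) (x y z : T).

Lemma join_indep J : join M J -> J \in indep M.
Proof.
case/andP=> JG /forallP jJ; apply/negPn/negP => Jd.
have [C cC CJ] := dependent_circuit JG Jd.
have := implyP (jJ C) cC; rewrite (setIidPr CJ) -addnn.
by have := circuit_neq0 cC; rewrite -card_gt0; lia.
Qed.

Lemma mu_ge J : join M J -> #|J| <= mu M.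
Proof. exact: (@leq_bigmax_cond _ _ (fun J : {set T} => #|J|)). Qed.

Lemma mu_le_rank : mu M <= rank M.
Proof.
apply/bigmax_leqP => J /join_indep Ji.
exact: (@leq_bigmax_cond _ _ _ J).
Qed.

(** A loop lies in no circuit other than itself, so it cannot be connected to a
    point of positive rank. *)
Lemma loopless_connected C : connected M -> 0 < rank M -> circuit M C -> 1 < #|C|.
Proof.
move=> /andP[_ /forallP conM]; rewrite -rk_ground => r_gt0 cC.
have [I Ii [IG eI]] := rk_attained M (ground M).
have /card_gt0P[x xI] : 0 < #|I| by rewrite eI.
rewrite ltnNge; apply/negP => C1.
have /cards1P[y eC] : #|C| == 1 by rewrite eqn_leq C1 card_gt0 (circuit_neq0 cC).
have yG : y \in ground M by apply: (subsetP (circuit_ground cC)); rewrite eC set11.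
have xy : x != y.
  apply: contraTneq Ii => exy; apply/negP => Ii.
  by have /negP := circuit_not_sub_indep cC Ii; apply; rewrite eC sub1set -exy.
have /implyP/(_ (subsetP IG x xI))/forallP/(_ y)/implyP/(_ yG)/implyP/(_ xy) := conM x.
case/existsP=> C' /and3P[cC' xC' yC'].
have eC' : C = C' by apply: circuit_sub cC' cC _; rewrite eC sub1set.
by move: xC'; rewrite -eC' eC inE (negPf xy).
Qed.

Hypothesis loopless : forall C, circuit M C -> 1 < #|C|.

Lemma mu_gt0 x : x \in ground M -> 0 < mu M.
Proof.
move=> xG; have jx : join M [set x].
  rewrite /join sub1set xG; apply/forallP => C; apply/implyP => /loopless.
  by have := subset_leq_card (subsetIl [set x] C); rewrite cards1; lia.
by have := mu_ge jx; rewrite cards1.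
Qed.

Hypothesis mu1 : mu M <= 1.

(** The pair is not a join, so some circuit [C] has fewer than twice as many points
    as it shares with the pair; as [#|C| >= 2], it contains both points. *)
Lemma short_circuit x y : x \in ground M -> y \in ground M -> x != y ->
  exists C, [/\ circuit M C, x \in C, y \in C & #|C| <= 3].
Proof.
move=> xG yG xy.
have: ~~ join M [set x; y].
  apply/negP => jxy.
  by have := leq_trans (mu_ge jxy) mu1; rewrite cards2 xy.
rewrite /join subUset !sub1set xG yG /= negb_forall => /existsP[C].
rewrite negb_imply -ltnNge => /andP[cC ltC]; exists C.
have := loopless cC.
have le2 : #|[set x; y] :&: C| <= 2.
  by have := subset_leq_card (subsetIl [set x; y] C); rewrite cards2 xy.
move=> C2; have e2 : #|[set x; y] :&: C| == #|[set x; y]| by rewrite cards2 xy; lia.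
have /eqP/setIidPl : [set x; y] :&: C == [set x; y].
  by rewrite eqEcard subsetIl (eqP e2) leqnn.
by rewrite subUset !sub1set => /andP[xC yC]; split=> //; lia.
Qed.

(** A rank criterion for (E3): every proper part of [C :\: D] is independent in
    [M / D], so it contains no trace of a circuit. *)
Lemma ear_of_rk D C : circuit M C -> C :&: D != set0 -> C :\: D != set0 ->
    (forall p, p \in C :\: D ->
       rk M D + #|(C :\: D) :\ p| <= rk M (D :|: (C :\: D) :\ p)) ->
  ear M D C.
Proof.
move=> cC CD CND hr; apply/and3P; split=> //.
apply/forallP => C'; apply/implyP => /and3P[cC' _ C'N0].
apply/negP => /properP[sC' [p pC pC']].
have := hr p pC; rewrite leqNgt => /negP; apply.
apply: rk_circuit_deficit cC' C'N0 _.
by rewrite -subDset subsetD1 sC' pC'.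
Qed.

(** A circuit with the one-point trace [x] outside [D] meets [D] because [x] is not
    a loop. *)
Lemma ear_single k D x : ear_built M k D -> x \in ground M -> x \notin D ->
  rk M (x |: D) = rk M D -> ear_built M k (x |: D).
Proof.
move=> eD xG xD /(spanned_circuit xG xD)[C [cC xC CxD]].
have eP : C :\: D = [set x].
  by apply/eqP; rewrite eqEsubset sub1set inE xD xC subDset setUC CxD.
have -> : x |: D = D :|: C.
  by rewrite -(setUD D C) eP setUC.
have -> : k = k + ~~ odd #|C :\: D| by rewrite eP cards1 addn0.
apply: ear_builtS => //; apply: ear_of_rk => //; rewrite ?eP.
- rewrite -card_gt0; have := cardsID D C; rewrite eP cards1.
  by have := loopless cC; lia.
- by apply/set0Pn; exists x; rewrite set11.
by move=> p /set1P->; rewrite setDv setU0 cards0 addn0.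
Qed.

Lemma ear_built_spanning k D : ear_built M k D -> rk M D = rank M ->
  ear_built M k (ground M).
Proof.
have [n] := ubnP #|ground M :\: D|; elim: n D => // n IHn D lt_n eD rD.
have DG := ear_built_ground eD.
have [GD|/subsetPn[x xG xD]] := boolP (ground M \subset D).
  by suff <- : D = ground M by []; apply/eqP; rewrite eqEsubset GD DG.
have rx : rk M (x |: D) = rk M D.
  apply: rk_squeeze (subsetUr _ _) _; rewrite rD -rk_ground.
  by rewrite rk_mono // subUset sub1set xG.
apply: (IHn (x |: D)); [|exact: ear_single|by rewrite rx].
rewrite -ltnS; apply: leq_trans lt_n; rewrite ltnS; apply: proper_card.
apply/properP; split; first by rewrite setDS ?subsetUr.
by exists x; rewrite !inE ?eqxx ?xD.
Qed.


(** Two points that raise the rank of [D] by two are non-parallel non-loops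
    of [M / D]. *)
Lemma rk2_distinct D p q : (rk M D).+2 <= rk M (D :|: [set p; q]) ->
  [/\ p != q, p \notin D & q \notin D].
Proof.
move=> h; split.
- have := leq_trans h (rkU_card M D [set p; q]).
  by rewrite cards2; case: (p != q) => //=; lia.
- apply: contraTN h => pD; rewrite -ltnNge ltnS.
  apply: leq_trans (rkU1 M q D); apply: rk_mono.
  by rewrite subUset subsetUr subUset !sub1set !inE pD eqxx orbT.
apply: contraTN h => qD; rewrite -ltnNge ltnS.
apply: leq_trans (rkU1 M p D); apply: rk_mono.
by rewrite subUset subsetUr subUset !sub1set !inE qD eqxx orbT.
Qed.

Lemma card3_eq C x y z : [set x; y; z] \subset C -> #|C| <= 3 ->
  x != y -> x != z -> y != z -> C = [set x; y; z].
Proof.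
move=> sC C3 xy xz yz; apply/esym/eqP; rewrite eqEcard sC (leq_trans C3) //.
by rewrite setUC cardsU1 !inE negb_or ![z == _]eq_sym xz yz cards2 xy.
Qed.

(** For [y] in [D], let [a'] be a third point of the line through [a] and [y], and
    [c] a third point of the line through [a'] and [b]. Modulo [D] the points
    [a] and [a'] are parallel, so [c] lies on the line through [a] and [b] and any
    two of [a], [b], [c] span it: the trace [[set a; b; c]] has no smaller
    competitor. In [M] itself, [c] lies on the plane through [y], [a] and [b],
    so that [y], [a], [b], [c] contain a circuit with this trace. *)
Lemma ear_triple k D a b : ear_built M k D -> a \in ground M -> b \in ground M ->
    (rk M D).+2 <= rk M (D :|: [set a; b]) ->
  exists2 D', ear_built M k D' & D \proper D'.
Proof.
move=> eD aG bG h_ab; have DG := ear_built_ground eD.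
have [ab aD bD] := rk2_distinct h_ab.
have /set0Pn[y yD] := ear_built_neq0 eD.
have yG := subsetP DG y yD.
have ya : y != a by apply: contraNneq aD => <-.
have yb : y != b by apply: contraNneq bD => <-.
have cyab : #|y |: [set a; b]| = 3 by rewrite cardsU1 !inE negb_or ya yb cards2 ab.
have yi : [set y] \in indep M.
  apply/negPn/negP => dep; have yG' : [set y] \subset ground M by rewrite sub1set.
  have [C cC /subset_leq_card] := dependent_circuit yG' dep.
  by rewrite cards1 leqNgt loopless.
(* Contracting [y] alone instead of [D] loses no rank on [a], [b]. *)
have ryab : rk M (y |: [set a; b]) = 3.
  apply/eqP; rewrite eqn_leq -{1}cyab rk_le_card.
  have yD' : [set y] \subset D by rewrite sub1set.
  have := rk_contract_anti M [set a; b] yD'.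
  rewrite (rk_indep yi) cards1 addn1 addnC => le_rk.
  by rewrite -(leq_add2l (rk M D)) (leq_trans _ le_rk) // addnS ltnS addn2.
have yabi : y |: [set a; b] \in indep M by apply: indep_of_rk; rewrite ryab cyab.
(* A third point [a'] of the line through [a] and [y]. *)
have ay : a != y by rewrite eq_sym.
have [C1 [cC1 aC1 yC1 C1_3]] := short_circuit aG yG ay.
have /subsetPn[a' a'C1 a'N] := circuit_not_sub_indep cC1 yabi.
move: a'N; rewrite !inE !negb_or => /and3P[a'y a'a a'b].
have eC1 : C1 = [set a; y; a'].
  by apply: card3_eq; rewrite // ?subUset ?sub1set ?aC1 ?yC1 // eq_sym.
have spanC1 x (A : {set T}) : x \in C1 -> C1 \subset x |: A -> rk M (x |: A) = rk M A.
  exact: rk_circuit_spans cC1.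
(* A third point [c] of the line through [a'] and [b]. *)
have a'G := subsetP (circuit_ground cC1) a' a'C1.
have [C2 [cC2 a'C2 bC2 C2_3]] := short_circuit a'G bG a'b.
have spanC2 x (A : {set T}) : x \in C2 -> C2 \subset x |: A -> rk M (x |: A) = rk M A.
  exact: rk_circuit_spans cC2.
have /subsetPn[c cC cN] : ~~ (C2 \subset [set a'; b]).
  apply/negP => sC2.
  have e1 : rk M (b |: (a' |: [set y; a])) = rk M (a' |: [set y; a]).
    apply: spanC2 => //; apply: subset_trans sC2 _.
    by rewrite subUset !sub1set !inE !eqxx !orbT.
  have e2 : rk M (a' |: [set y; a]) = rk M [set y; a].
    apply: spanC1 => //; rewrite eC1.
    by rewrite !subUset !sub1set !inE !eqxx !orbT.
  have : rk M (y |: [set a; b]) <= rk M (b |: (a' |: [set y; a])).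
    by apply: rk_mono; rewrite !subUset !sub1set !inE !eqxx !orbT.
  have := rk_le_card M [set y; a].
  by rewrite ryab e1 e2 cards2 ya => le2 /leq_trans/(_ le2).
move: cN; rewrite !inE negb_or => /andP[ca' cb].
have eC2 : C2 = [set a'; b; c].
  by apply: card3_eq; rewrite // ?subUset ?sub1set ?a'C2 ?bC2 // eq_sym.
(* Modulo [D], two of [a], [b], [c] span [a'] and then the third. *)
have h_bc : (rk M D).+2 <= rk M (D :|: [set b; c]).
  have e1 : rk M (a' |: (D :|: [set b; c])) = rk M (D :|: [set b; c]).
    by apply: spanC2; rewrite // eC2 !subUset !sub1set !inE !eqxx !orbT.
  have e2 : rk M (a |: (a' |: (D :|: [set b; c]))) = rk M (a' |: (D :|: [set b; c])).
    by apply: spanC1; rewrite // eC1 !subUset !sub1set !inE yD !eqxx !orbT.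
  rewrite -e1 -e2; apply: leq_trans h_ab _; apply: rk_mono.
  rewrite !subUset !sub1set !inE !eqxx !orbT !andbT /=.
  by apply/subsetP => z zD; rewrite !inE zD !orbT.
have h_ac : (rk M D).+2 <= rk M (D :|: [set a; c]).
  have e1 : rk M (a' |: (D :|: [set a; c])) = rk M (D :|: [set a; c]).
    by apply: spanC1; rewrite // eC1 !subUset !sub1set !inE yD !eqxx !orbT.
  have e2 : rk M (b |: (a' |: (D :|: [set a; c]))) = rk M (a' |: (D :|: [set a; c])).
    by apply: spanC2; rewrite // eC2 !subUset !sub1set !inE !eqxx !orbT.
  rewrite -e1 -e2; apply: leq_trans h_ab _; apply: rk_mono.
  rewrite !subUset !sub1set !inE !eqxx !orbT !andbT /=.
  by apply/subsetP => z zD; rewrite !inE zD !orbT.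
have [ac _ cD] := rk2_distinct h_ac.
pose P := [set a; b; c].
have bc : b != c by rewrite eq_sym.
have cP : #|P| = 3.
  by rewrite /P setUC cardsU1 !inE negb_or ![c == _]eq_sym ac bc cards2 ab.
have h_P p : p \in P -> (rk M D).+2 <= rk M (D :|: P :\ p).
  rewrite /P !inE => /orP[/orP[]|] /eqP ->;
    [apply: leq_trans h_bc _|apply: leq_trans h_ac _|apply: leq_trans h_ab _];
    apply/rk_mono/setUS; rewrite subUset !sub1set !inE !eqxx ?orbT ?andbT /=.
  - by rewrite ![_ == a]eq_sym ab ac.
  - by rewrite ab eq_sym.
  by rewrite ac bc.
have cPp p : p \in P -> #|P :\ p| = 2.
  by move=> pP; have := cardsD1 p P; rewrite pP cP => -[].
have yc : y != c by apply: contraNneq cD => <-.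
(* The plane through [y], [a], [b] contains [a'] and hence [c]. *)
have dep : y |: P \notin indep M.
  apply/negP => i; have := rk_indep i; rewrite cardsU1 cP.
  have -> : y \notin P by rewrite !inE !negb_or ya yb yc.
  have e1 : rk M (a' |: (y |: [set a; b])) = rk M (y |: [set a; b]).
    by apply: spanC1; rewrite // eC1 !subUset !sub1set !inE !eqxx !orbT.
  have e2 : rk M (c |: (a' |: (y |: [set a; b]))) = rk M (a' |: (y |: [set a; b])).
    by apply: spanC2; rewrite // eC2 !subUset !sub1set !inE !eqxx !orbT.
  have : rk M (y |: P) <= rk M (c |: (a' |: (y |: [set a; b]))).
    by apply: rk_mono; rewrite !subUset !sub1set !inE !eqxx !orbT.
  by rewrite e2 e1 ryab => le3 e4; rewrite e4 in le3.
have cG := subsetP (circuit_ground cC2) c cC.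
have [|C cirC sC] := dependent_circuit _ dep.
  by rewrite !subUset !sub1set yG aG bG cG.
have CDP : C :\: D \subset P.
  apply/subsetP => z; rewrite inE => /andP[zD /(subsetP sC)].
  by rewrite in_setU1 => /orP[/eqP ez|//]; rewrite ez yD in zD.
have CND : C :\: D != set0.
  apply/negP; rewrite setD_eq0 => CD.
  have := loopless cirC; rewrite ltnNge => /negP; apply.
  rewrite -(cards1 y) subset_leq_card //; apply/subsetP => z zC.
  have := subsetP sC z zC; have zD := subsetP CD z zC.
  rewrite !inE => /orP[//|/orP[/orP[]|]] /eqP ez; move: zD;
  by rewrite ez ?(negPf aD) ?(negPf bD) ?(negPf cD).
have eP : C :\: D = P.
  apply/eqP; rewrite eqEsubset CDP; apply/subsetP => p pP.
  apply/negPn/negP => pC.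
  have sCP : C \subset D :|: P :\ p by rewrite -subDset subsetD1 CDP.
  have := rk_circuit_deficit cirC CND sCP.
  by rewrite cPp // addn2 ltnNge h_P.
(* If [C] were [[set a; b; c]], the line through [b] and [c] would contain [a],
   then [a'], then [y], although [y], [a], [b] have rank three. *)
have yC : y \in C.
  apply/negPn/negP => yC.
  have CP : C \subset P by rewrite -(setU1K (_ : y \notin P)) ?subsetD1 ?sC // !inE !negb_or ya yb yc.
  have e0 : rk M (a |: [set b; c]) = rk M [set b; c].
    apply: rk_circuit_spans cirC _ _; last by rewrite setUA.
    by apply: (subsetP (subsetDl C D)); rewrite eP !inE eqxx.
  have e1 : rk M (a' |: (a |: [set b; c])) = rk M (a |: [set b; c]).
    by apply: spanC2; rewrite // eC2 !subUset !sub1set !inE !eqxx !orbT.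
  have e2 : rk M (y |: (a' |: (a |: [set b; c]))) = rk M (a' |: (a |: [set b; c])).
    by apply: spanC1; rewrite // eC1 !subUset !sub1set !inE !eqxx !orbT.
  have : rk M (y |: [set a; b]) <= rk M (y |: (a' |: (a |: [set b; c]))).
    by apply: rk_mono; rewrite !subUset !sub1set !inE !eqxx !orbT.
  have := rk_le_card M [set b; c].
  by rewrite e2 e1 e0 ryab cards2 bc => le2 /leq_trans/(_ le2).
have earC : ear M D C.
  apply: ear_of_rk => //; first by apply/set0Pn; exists y; rewrite inE yC.
  by move=> p; rewrite eP => pP; rewrite cPp // addn2 h_P.
exists (D :|: C).
  by have := ear_builtS eD cirC earC; rewrite eP cP addn0.
apply/properP; split; first exact: subsetUl.
exists a => //; rewrite inE; apply/orP; right.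
by apply: (subsetP (subsetDl C D)); rewrite eP !inE eqxx.
Qed.

(** The lobe has at most two points since the circuit meets [D], and more than one
    since [D] is closed. *)
Lemma ear_double k D x : ear_built M k D -> x \in ground M -> x \notin D ->
    (forall z, z \in ground M -> z \notin D -> rk M D < rk M (z |: D)) ->
  exists2 D', ear_built M k.+1 D' & x |: D \subset D'.
Proof.
move=> eD xG xD flat; have DG := ear_built_ground eD.
have /set0Pn[y yD] := ear_built_neq0 eD.
have xy : x != y by apply: contraNneq xD => ->.
have [C [cC xC yC C3]] := short_circuit xG (subsetP DG y yD) xy.
have CG := circuit_ground cC.
have CD : C :&: D != set0 by apply/set0Pn; exists y; rewrite inE yC.
have xP : x \in C :\: D by rewrite inE xD.
have CND : C :\: D != set0 by apply/set0Pn; exists x.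
have cP : #|C :\: D| = 2.
  have := cardsID D C; rewrite -card_gt0 in CD => eC.
  suff: #|C :\: D| != 1.
    by move: CND eC C3 CD; rewrite -card_gt0; clear; lia.
  apply/negP => /cards1P[z ez]; have ezx : z = x by move: xP; rewrite ez => /set1P.
  have := flat x xG xD; rewrite (rk_circuit_spans cC xC) ?ltnn //.
  by rewrite setUC -subDset ez ezx.
have earC : ear M D C.
  apply: ear_of_rk => // p pP.
  have c1 : #|(C :\: D) :\ p| = 1.
    by have := cardsD1 p (C :\: D); rewrite pP cP => -[].
  have /cards1P[z ez] : #|(C :\: D) :\ p| == 1 by rewrite c1.
  have : z \in (C :\: D) :\ p by rewrite ez set11.
  rewrite in_setD1 in_setD => /and3P[_ zD zC].
  by rewrite c1 addn1 ez setUC flat // (subsetP CG).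
exists (D :|: C); first by have := ear_builtS eD cC earC; rewrite cP addn1.
by rewrite subUset sub1set inE xC orbT subsetUl.
Qed.

(** An even lobe is used only when one rank is missing, after which every
    remaining point is spanned; this is why [k] grows by at most one. *)
Lemma ear_built_completion k D : ear_built M k D ->
  exists2 k', k' <= k.+1 & ear_built M k' (ground M).
Proof.
have [n] := ubnP #|ground M :\: D|; elim: n D => // n IHn D lt_n eD.
have DG := ear_built_ground eD.
have IH D' : ear_built M k D' -> D \proper D' ->
    exists2 k', k' <= k.+1 & ear_built M k' (ground M).
  move=> eD' /properP[DD' [z zD' zD]]; apply: (IHn D') => //.
  rewrite -ltnS; apply: leq_trans lt_n; rewrite ltnS; apply: proper_card.
  apply/properP; split; first by rewrite setDS.
  have zG := subsetP (ear_built_ground eD') z zD'.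
  by exists z; rewrite !inE ?zD ?zD'.
have [GD|/subsetPn[x xG xD]] := boolP (ground M \subset D).
  exists k => //; suff <- : D = ground M by [].
  by apply/eqP; rewrite eqEsubset GD DG.
have [/exists_inP[z zG /andP[zD /eqP rz]]|/exists_inPn flat0] :=
  boolP [exists z in ground M, (z \notin D) && (rk M (z |: D) == rk M D)].
  apply: (IH (z |: D)); first exact: ear_single.
  by apply/properP; split; [exact: subsetUr|exists z; rewrite ?in_setU1 ?eqxx].
have flat z : z \in ground M -> z \notin D -> rk M D < rk M (z |: D).
  move=> zG zD; have := flat0 z zG; rewrite zD /= => ne.
  by rewrite ltn_neqAle eq_sym ne rk_mono ?subsetUr.
have [/exists_inP[b bG hb]|/exists_inPn hx] :=
  boolP [exists b in ground M, (rk M D).+2 <= rk M (D :|: [set x; b])].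
  by have [D' eD' DD'] := ear_triple eD xG bG hb; apply: IH eD' DD'.
have [D' eD' xDD'] := ear_double eD xG xD flat.
have D'G := ear_built_ground eD'.
exists k.+1 => //; apply: ear_built_spanning eD' _.
apply/eqP; rewrite eqn_leq -rk_ground rk_mono //=.
have -> : rk M (ground M) = rk M (x |: D).
  have e : (x |: D) :|: ground M = ground M.
    by apply/setUidPr; rewrite subUset sub1set xG.
  rewrite -e; apply: rk_closure => b bG; apply: rk_squeeze (subsetUr _ _) _.
  have := hx b bG; rewrite -ltnNge ltnS => h.
  apply: leq_trans (leq_trans h (flat x xG xD)).
  by rewrite setUA setUC [b |: _]setUC.
exact: rk_mono.
Qed.

(** In rank at least two the construction starts from a triangle, which is an odd
    lobe; rank one is covered by [phi <= rank]. *)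
Lemma phi_le1 :
  (exists k, ear_built M k (ground M)) -> phi M <= 1.
Proof.
move=> [k0 /phi_rank[le_phi _]].
have [r1|r2] := leqP (rank M) 1; first exact: leq_trans le_phi r1.
have [I Ii [IG eI]] := rk_attained M (ground M).
rewrite rk_ground in eI.
have /card_gt1P[x [y [xI yI xy]]] : 1 < #|I| by rewrite eI.
have [C [cC xC yC C3]] := short_circuit (subsetP IG x xI) (subsetP IG y yI) xy.
have sxy : [set x; y] \subset C by rewrite subUset !sub1set xC.
have /subsetPn[z zC] := circuit_not_sub_indep cC Ii.
move=> zI; have c3 : #|C| = 3.
  apply/eqP; rewrite eqn_leq C3.
  have : z |: [set x; y] \subset C by rewrite subUset sub1set zC.
  move/subset_leq_card; rewrite cardsU1 cards2 xy !inE negb_or.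
  by rewrite (contraNneq _ zI) ?(contraNneq _ zI) // => ->.
have := ear_built1 cC; rewrite c3 => /ear_built_completion[k' le_k' ek'].
exact: leq_trans (phi_le_built ek') le_k'.
Qed.

End Joins.

(** * Existence of a circuit *)

Section Existence.
Variables (T : finType) (M : matroid T).

Lemma isomorphic_uniform11 (x : T) : ground M = [set x] -> [set x] \in indep M ->
  isomorphic M (uniform 1 1).
Proof.
move=> eG xi; have xG : x \in ground M by rewrite eG set11.
have yG : ord0 \in ground (uniform 1 1) by rewrite inE.
exists (fun _ => exist _ ord0 yG).
  exists (fun _ => exist _ x xG) => [[z zG]|[z zG]]; apply: val_inj => /=.
    by move: zG; rewrite eG => /set1P.
  by rewrite [z]ord1.
move=> A; rewrite inE (leq_trans (max_card _)) ?card_ord //.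
apply: indepS xi; apply/subsetP => _ /imsetP[[z zG] _ ->] /=.
by rewrite -eG.
Qed.

Lemma connected_circuit : connected M -> ~ isomorphic M (uniform 1 1) ->
  exists C, circuit M C.
Proof.
move=> /andP[/set0Pn[x xG] /forallP conM] niso.
have [xi|xd] := boolP ([set x] \in indep M); last first.
  have [|C cC _] := dependent_circuit _ xd; first by rewrite sub1set.
  by exists C.
have [Gx|/subsetPn[y yG yx]] := boolP (ground M \subset [set x]).
  case: niso; apply: (@isomorphic_uniform11 x) => //.
  by apply/eqP; rewrite eqEsubset Gx sub1set.
have xy : x != y by move: yx; rewrite inE eq_sym.
have /implyP/(_ xG)/forallP/(_ y)/implyP/(_ yG)/implyP/(_ xy) := conM x.
by case/existsP=> C /andP[cC _]; exists C.
Qed.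

End Existence.

(** * The two bounds *)

Import Order.TTheory GRing.Theory Num.Theory.

Lemma ceil_half n : ((Num.ceil (n%:R / 2 : rat))%:~R = (uphalf n)%:R :> rat)%R.
Proof.
rewrite (@ceil_def _ _ (Posz (uphalf n))) // rmorphB /= -pmulrn.
have -> : (n%:R = (odd n)%:R + 2 * n./2%:R :> rat)%R.
  by rewrite -natrM mul2n -natrD odd_double_half.
by rewrite uphalf_half natrD; case: odd => /=; lra.
Qed.
Theorem theorem4p7 (T : finType) (M : matroid T) :
  connected M ->
  ~ isomorphic M (uniform 1 1) ->
  ((Num.ceil ((mu M)%:R / 2 : rat))%:~R <= eta M
     <= (Num.ceil ((rank M)%:R / 2 : rat))%:~R * (mu M)%:R)%R.
Proof.
move=> conM niso; have [C0 cC0] := connected_circuit conM niso.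
have [k ek] := ear_built_connected conM (ear_built1 cC0).
have [phi_r phi_odd] := phi_rank ek.
have mu_r := mu_le_rank M.
have [lo up] : (uphalf (mu M)).*2 <= rank M + phi M /\
    rank M + phi M <= (uphalf (rank M) * mu M).*2.
  have [r0|r_gt0] := posnP (rank M).
    by move: mu_r phi_r; rewrite r0 !leqn0 => /eqP-> /eqP->.
  have loopless C := @loopless_connected T M C conM r_gt0.
  have mu_gt : 0 < mu M.
    by have /andP[/set0Pn[x xG] _] := conM; apply: mu_gt0 xG.
  split; first lia.
  have [mu1|mu2] := leqP (mu M) 1.
    have := phi_le1 loopless mu1 (ex_intro _ k ek).
    have -> : mu M = 1 by lia.
    lia.
  have := leq_mul (leqnn (uphalf (rank M))) mu2; lia.
rewrite !ceil_half /eta ler_pdivlMr // ler_pdivrMr //.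
by rewrite -natrD -!natrM !ler_nat !muln2 lo.
Qed.
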